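(* Let $\mathbf{C}\in\mathcal{S}^n$, $\mathbf{b}\in\mathbb{R}^m$, and let $\mathcal{A}:\mathcal{S}^n\to\mathbb{R}^m$ be a linear map whose adjoint $\mathcal{A}^*:\mathbb{R}^m\to\mathcal{S}^n$ is injective. For every fixed $\varepsilon>0$, the function $G_\varepsilon:\mathbb{R}^m\to\mathbb{R}$, $$G_\varepsilon(\lambda):=\mathbf{b}^T\lambda+\inf_{X}\{\mathrm{Tr}(X\cdot(\mathbf{C}-\mathcal{A}^*\lambda))+\varepsilon\,\mathrm{Tr}(X\cdot\ln(X))\},$$ where the infimum is over $X\in\mathcal{S}^n$ with $X\succeq0$, is strictly concave and satisfies, for all $\lambda\in\mathbb{R}^m$, $$G_\varepsilon(\lambda)=\mathbf{b}^T\lambda-\varepsilon\,\mathrm{Tr}\,X(\lambda),\qquad\text{with}\quad X(\lambda)=\exp\big((\mathcal{A}^*\lambda-\mathbf{C})/\varepsilon-\mathbf{I}\big).$$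
   Context: $\mathcal{S}^n$ is the space of real symmetric $n\times n$ matrices with inner product $\langle X,Y\rangle=\mathrm{Tr}(X\cdot Y)$; $\mathbb{R}^m$ carries the standard inner product, and $\mathcal{A}^*$ is the adjoint of $\mathcal{A}$ for these inner products. $\exp$ is the matrix exponential and $\mathbf{I}$ the identity matrix. For $X\succeq0$ with eigenvalues $\sigma_1,\ldots,\sigma_n$, $\mathrm{Tr}(X\cdot\ln(X)):=\sum_{i=1}^n\sigma_i\ln(\sigma_i)$ with the convention $0\ln 0=0$. *)

(* Defs.v *)
From HB Require Import structures.
From mathcomp Require Import all_boot all_order all_algebra.
From mathcomp Require Import all_classical all_reals all_analysis.

Set Implicit Arguments.
Unset Strict Implicit.
Unset Printing Implicit Defensive.

Import Order.TTheory GRing.Theory Num.Theory.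
Import numFieldNormedType.Exports.

Local Open Scope classical_set_scope.
Local Open Scope ring_scope.

Lemma symmetricmxP (F : fieldType) (n : nat) (X : 'M[F]_n) :
  reflect (X^T = X) (X \is symmetricmx).
Proof.
by rewrite is_hermitianmxE scale1r map_mx_id //; apply: (iffP eqP) => [{2}->|->].
Qed.

Lemma symmetricmx_submod_closed (F : fieldType) (n : nat) :
  submod_closed (symmetricmx : {pred 'M[F]_n}).
Proof.
split=> [|a X Y /symmetricmxP hX /symmetricmxP hY]; apply/symmetricmxP.
  exact: trmx0.
by rewrite linearP /= hX hY.
Qed.

HB.instance Definition _ (F : fieldType) (n : nat) :=
  GRing.isSubmodClosed.Build F 'M[F]_n
    (symmetricmx : {pred 'M[F]_n}) (@symmetricmx_submod_closed F n).

Record symmat (F : fieldType) (n : nat) : Type :=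
  SymMat { symmat_mx :> 'M[F]_n; symmat_proof : symmat_mx \is symmetricmx }.

HB.instance Definition _ (F : fieldType) (n : nat) :=
  [isSub for @symmat_mx F n].
HB.instance Definition _ (F : fieldType) (n : nat) :=
  [Choice of symmat F n by <:].
HB.instance Definition _ (F : fieldType) (n : nat) :=
  [SubChoice_isSubLmodule of symmat F n by <:].

Lemma symmat_mx_is_linear (F : fieldType) (n : nat) :
  linear (@symmat_mx F n).
Proof. by []. Qed.

HB.instance Definition _ (F : fieldType) (n : nat) :=
  GRing.isLinear.Build F (symmat F n) 'M[F]_n _ (@symmat_mx F n)
    (@symmat_mx_is_linear F n).

Definition innerS (F : fieldType) (n : nat) (X Y : symmat F n) : F :=
  \tr (X *m Y).

Definition innerV (F : fieldType) (m : nat) (u v : 'cV[F]_m) : F :=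
  (u^T *m v) 0 0.

Definition is_adjoint (F : fieldType) (n m : nat)
    (A : symmat F n -> 'cV[F]_m) (B : 'cV[F]_m -> symmat F n) : Prop :=
  forall X l, innerS X (B l) = innerV (A X) l.

Lemma adjoint_exists (F : numFieldType) (n m : nat)
    (A : {linear symmat F n -> 'cV[F]_m}) :
  exists B : {linear 'cV[F]_m -> symmat F n}, is_adjoint A B.
Proof.
pose e i j : 'M[F]_n := 2^-1 *: (delta_mx i j + delta_mx j i).
have eP i j : e i j \is symmetricmx.
  by apply/symmetricmxP; rewrite linearZ linearD /= !trmx_delta addrC.
pose E i j := SymMat (eP i j).
pose f (l : 'cV[F]_m) : symmat F n :=
  \sum_i \sum_j innerV (A (E i j)) l *: E i j.
have f_linear : linear f.
  move=> a u v; rewrite /f scaler_sumr -big_split; apply: eq_bigr => i _.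
  rewrite scaler_sumr -big_split; apply: eq_bigr => j _ /=.
  by rewrite scalerA -scalerDl /innerV mulmxDr -scalemxAr !mxE.
pose fM := GRing.isLinear.Build F 'cV[F]_m (symmat F n) _ f f_linear.
pose fL : {linear 'cV[F]_m -> symmat F n} := HB.pack f fM.
exists fL => X l; rewrite /fL /=.
have X_sym i j : X j i = X i j.
  by have /symmetricmxP/matrixP/(_ i j) := symmat_proof X; rewrite mxE.
have XE : X = \sum_i \sum_j X i j *: E i j.
  apply: val_inj; rewrite /= raddf_sum /=.
  transitivity (2^-1 *: ((X : 'M[F]_n) + (X : 'M[F]_n)^T)).
    have /symmetricmxP -> := symmat_proof X.
    by rewrite scalerDr -scalerDl -div1r -splitr scale1r.
  rewrite {1 2}[symmat_mx X]matrix_sum_delta.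
  rewrite linear_sum -big_split scaler_sumr; apply: eq_bigr => i _ /=.
  rewrite raddf_sum linear_sum -big_split scaler_sumr.
  apply: eq_bigr => j _ /=.
  by rewrite /e linearZ /= trmx_delta -scalerDr !scalerA mulrC.
have trXE i j : \tr (X *m E i j) = X i j.
  have tr_delta k h : \tr ((X : 'M[F]_n) *m delta_mx k h) = X h k.
    rewrite /mxtrace (bigD1 h) //= big1 ?addr0 => [|p ph].
      rewrite mxE (bigD1 k) //= big1 ?addr0 => [|q qk]; last first.
        by rewrite mxE (negbTE qk) mulr0.
      by rewrite mxE !eqxx mulr1.
    by rewrite mxE big1 // => q _; rewrite mxE (negbTE ph) andbF mulr0.
  rewrite /= /e -scalemxAr mulmxDr mxtraceZ mxtraceD !tr_delta X_sym.
  by rewrite mulrDr -mulrDl -div1r -splitr mul1r.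
transitivity (\sum_i \sum_j innerV (A (E i j)) l * X i j).
  rewrite /innerS /f (raddf_sum (@symmat_mx F n)) mulmx_sumr.
  rewrite (raddf_sum (@mxtrace F n)); apply: eq_bigr => i _.
  rewrite (raddf_sum (@symmat_mx F n)) mulmx_sumr.
  rewrite (raddf_sum (@mxtrace F n)); apply: eq_bigr => j _.
  by rewrite -trXE -mxtraceZ scalemxAr.
rewrite [in RHS]XE linear_sum /innerV !linear_sum mulmx_suml summxE.
apply: eq_bigr => i _; rewrite !linear_sum mulmx_suml summxE.
apply: eq_bigr => j _.
by rewrite (linearZ_LR A) linearZ_LR -scalemxAl [RHS]mxE mulrC.
Qed.

Definition adjoint (F : numFieldType) (n m : nat)
    (A : {linear symmat F n -> 'cV[F]_m}) :
    {linear 'cV[F]_m -> symmat F n} :=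
  sval (cid (adjoint_exists A)).

Lemma adjointP (F : numFieldType) (n m : nat)
    (A : {linear symmat F n -> 'cV[F]_m}) : is_adjoint A (adjoint A).
Proof. exact: svalP (cid (adjoint_exists A)). Qed.

Definition psdmx (F : numFieldType) (n : nat) (X : 'M[F]_n) : Prop :=
  forall v : 'cV[F]_n, 0 <= (v^T *m X *m v) 0 0.

Definition expmx (R : realType) (n : nat) (A : 'M[R]_n) : 'M[R]_n :=
  limn (series (fun k => k`!%:R^-1 *: A ^+ k)).

(* The eigenvalues with multiplicity, in an unspecified order.  The default
   [::] is only reached when the characteristic polynomial does not split,
   which cannot happen for a symmetric matrix. *)
Definition eigenvalues (R : realType) (n : nat) (X : 'M[R]_n) : seq R :=
  xget [::] [set s : seq R | char_poly X = \prod_(a <- s) ('X - a%:P)].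

(* ln a = 0 for a <= 0 in the library, hence 0 * ln 0 = 0. *)
Definition tr_xlnx (R : realType) (n : nat) (X : 'M[R]_n) : R :=
  \sum_(a <- eigenvalues X) a * ln a.

Section DualFunction.
Context (R : realType) (n m : nat).
Variables (C : symmat R n) (b : 'cV[R]_m).
Variables (A : {linear symmat R n -> 'cV[R]_m}) (eps : R).

(* The infimum is taken in the extended reals because inf on R is 0 for a
   set that is not bounded below. *)
Definition G_eps (l : 'cV[R]_m) : \bar R :=
  (((b^T *m l) 0 0)%R%:E +
   ereal_inf [set (\tr (X *m (C - adjoint A l : symmat R n))
                   + eps * tr_xlnx X)%R%:E
             | X in [set X : symmat R n | psdmx X]])%E.

Definition X_eps (l : 'cV[R]_m) : 'M[R]_n :=
  expmx (eps^-1 *: ((adjoint A l - C : symmat R n) : 'M[R]_n) - 1%:M).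

End DualFunction.

Definition strictly_concave (R : numDomainType) (E : lmodType R) (f : E -> R) :
    Prop :=
  forall (x y : E) (t : R), x != y -> 0 < t < 1 ->
    t * f x + (1 - t) * f y < f (t *: x + (1 - t) *: y).

(* Main.v *)
Require Import Defs.
From HB Require Import structures.
From mathcomp Require Import all_boot all_order all_algebra.
From mathcomp Require Import all_classical all_reals all_analysis.
From mathcomp Require Import complex ring lra.

Set Implicit Arguments.
Unset Strict Implicit.
Unset Printing Implicit Defensive.

Import Order.TTheory GRing.Theory Num.Theory.
Import numFieldNormedType.Exports.

Local Open Scope classical_set_scope.
Local Open Scope ring_scope.

(* Put M = (A^* l - C) / eps - I. The objective equals eps * F(X, M) with
   F(X, M) = Tr(X ln X) - Tr X - Tr(X M). Diagonalizing X and M in orthonormal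
   bases with eigenvalues s_i and t_j, and writing W for the orthogonal matrix
   relating the two bases,
     F(X, M) + Tr(exp M) = sum_ij W_ij^2 (s_i ln s_i - s_i - s_i t_j + exp t_j),
   where each summand is nonnegative and vanishes only if W_ij = 0 or
   s_i = exp t_j (Klein's inequality). Hence F(., M) is minimized exactly at
   X = exp M, with value - Tr(exp M). Strict concavity follows by testing the
   minimizer at t x + (1 - t) y in the problems for x and for y: F is affine in
   M, and the minimizers differ because exp is injective on symmetric
   matrices. *)

(** * Spectral theorem for real symmetric matrices *)

Lemma row_sqnorm_gt0 (R : realDomainType) (n : nat) (u : 'rV[R]_n) :
  u != 0 -> 0 < (u *m u^T) 0 0.
Proof.
have -> : (u *m u^T) 0 0 = \sum_j u 0 j ^+ 2.
  by rewrite mxE; apply: eq_bigr => j _; rewrite [u^T _ _]mxE expr2.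
move=> u0; rewrite lt0r sumr_ge0 ?andbT => [|j _]; last exact: sqr_ge0.
apply: contra u0; rewrite psumr_eq0 => [/allP u0|j _]; last exact: sqr_ge0.
apply/eqP/rowP => j; rewrite [RHS]mxE; apply/eqP.
by rewrite -sqrf_eq0; apply: (implyP (u0 j _)); rewrite ?mem_index_enum.
Qed.

(** Over [R[i]] the matrix is Hermitian, so it is unitarily diagonalizable with a real diagonal. An
    eigenvalue of the complexified matrix that comes from [R] is already an eigenvalue over [R]. *)
Lemma symmetric_eigenvalue (R : rcfType) (n : nat) (X : 'M[R]_n.+1) :
  X \is symmetricmx -> exists a, eigenvalue X a.
Proof.
move=> /symmetricmxP Xsym.
pose f : {rmorphism R -> R[i]} := real_complex R.
have Xherm : map_mx f X \is hermsymmx.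
  apply: realsym_hermsym; first by apply/symmetricmxP; rewrite map_trmx Xsym.
  by apply/mxOverP => i j; rewrite mxE complex_real.
have /hermitian_normalmx/orthomx_spectralP XE := Xherm.
set P := spectralmx _ in XE; set d := spectral_diag _ in XE.
have Punit : P \in unitmx by exact: spectral_unit.
have /mxOverP/(_ 0 0)/complex_realP[k dk] := hermitian_spectral_diag_real Xherm.
exists k; rewrite -(eigenvalue_map f); apply/eigenvalueP.
exists (row 0 P); last first.
  apply/eqP => P0; have /rowP/(_ 0)/eqP := row_mul 0 P (invmx P).
  by rewrite P0 mul0mx mulmxV // !mxE eqxx oner_eq0.
by rewrite -row_mul XE mulmxA mulKVmx // row_mul row_diag_mx -scalemxAl -rowE dk.
Qed.

Lemma orthogonal_first_row (R : realFieldType) (n : nat) (v : 'rV[R]_n.+1) :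
  v *m v^T = 1%:M -> exists2 H : 'M[R]_n.+1, H *m H^T = 1%:M & row 0 H = v.
Proof.
move=> v1; pose e : 'rV[R]_n.+1 := delta_mx 0 0.
have e1 : e *m e^T = 1%:M.
  by rewrite trmx_delta mul_delta_mx; apply/matrixP => i j; rewrite !ord1 !mxE.
have [->|ev] := eqVneq v e.
  by exists 1%:M; rewrite ?trmx1 ?mulmx1 // rowE mulmx1.
(* Householder reflection exchanging v and the first basis vector. *)
pose w := e - v; pose c := (w *m w^T) 0 0.
have c0 : c != 0.
  by rewrite gt_eqF // row_sqnorm_gt0 // subr_eq0 eq_sym.
have wwT : w *m w^T = c%:M by rewrite [LHS]mx11_scalar.
have evT : v *m e^T = e *m v^T.
  by rewrite [LHS]mx11_scalar -tr_scalar_mx -mx11_scalar trmx_mul trmxK.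
(* Both [e] and [v] are unit vectors, so [c = |e - v|^2 = 2 - 2 <e, v> = 2 <e, w>]. Hence the
   reflection sends [e] to [e - w = v]. *)
have ewT : e *m w^T = (c / 2)%:M.
  rewrite mulrC -scale_scalar_mx.
  have -> : c%:M = 2 *: (e *m w^T).
    rewrite -wwT {1}/w mulmxBl /w linearB /= !mulmxBr e1 v1 evT scaler_nat mulr2n.
    by rewrite opprB.
  by rewrite scalerA mulVf ?scale1r ?pnatr_eq0.
exists (1%:M - (2 / c) *: (w^T *m w)).
  have SS : w^T *m w *m (w^T *m w) = c *: (w^T *m w).
    by rewrite mulmxA -(mulmxA _ w) wwT mul_mx_scalar scalemxAl.
  rewrite [X in _ *m X]linearB [X in _ *m (_ - X)]linearZ /= trmx1 trmx_mul trmxK.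
  rewrite mulmxBr mulmx1 mulmxBl mul1mx -scalemxAl -scalemxAr SS !scalerA.
  rewrite (_ : 2 / c * _ * c = 2 / c + 2 / c); last by field.
  by rewrite scalerDl opprB addrK subrK.
rewrite rowE mulmxBr mulmx1 -scalemxAr mulmxA ewT mul_scalar_mx scalerA.
rewrite (_ : _ * _ = 1); first by rewrite scale1r opprB addrC subrK.
by field.
Qed.

(** Deflation: a unit eigenvector is completed to an orthogonal matrix [H], conjugation by [H]
    splits off a 1 by 1 block, and induction applies to the remaining symmetric block. *)
Lemma symmetric_diagonalizable (R : rcfType) (n : nat) (X : 'M[R]_n) :
  X \is symmetricmx ->
  exists (P : 'M[R]_n) (d : 'rV[R]_n),
    P *m P^T = 1%:M /\ X = P^T *m diag_mx d *m P.
Proof.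
elim: n X => [|n IHn] X Xsym.
  by exists 1%:M, 0; split; apply/matrixP => -[].
have [a /eigenvalueP[u uX u0]] := symmetric_eigenvalue Xsym.
have {Xsym}/symmetricmxP Xsym := Xsym.
pose c := (u *m u^T) 0 0.
have c0 : 0 < c by exact: row_sqnorm_gt0.
pose v := (Num.sqrt c)^-1 *: u.
have v1 : v *m v^T = 1%:M.
  rewrite linearZ /= -scalemxAl -scalemxAr scalerA [u *m u^T]mx11_scalar -/c scale_scalar_mx.
  rewrite -invfM -expr2 sqr_sqrtr ?ltW // mulVf // gt_eqF //.
have vX : v *m X = a *: v by rewrite -scalemxAl uX scalerA mulrC -scalerA.
have [H HHT H0] := orthogonal_first_row v1.
have HTH : H^T *m H = 1%:M by exact: mulmx1C.
pose Y : 'M[R]_(1 + n) := H *m X *m H^T.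
have Ysym : Y^T = Y by rewrite !trmx_mul trmxK Xsym mulmxA.
(* Row 0 of [H] is the eigenvector [v], so row 0 of [Y] is [a] times the first basis vector;
   symmetry then clears column 0 as well. *)
have Y0 j : Y 0 j = a * (j == 0)%:R.
  have -> : Y 0 j = (row 0 Y) 0 j by rewrite [RHS]mxE.
  rewrite !row_mul H0 vX -scalemxAl -H0 -row_mul HHT !mxE.
  by rewrite eq_sym.
have XE : X = H^T *m Y *m H.
  by rewrite !mulmxA HTH mul1mx -mulmxA HTH mulmx1.
clearbody Y.
have Yur : ursubmx Y = 0.
  by apply/matrixP => i j; rewrite !ord1 !mxE lshift0 Y0 mulr0.
have YE : Y = block_mx a%:M 0 0 (drsubmx Y).
  rewrite -[LHS]submxK Yur; congr block_mx.
    by apply/matrixP => i j; rewrite !ord1 !mxE !lshift0 Y0 eqxx mulr1.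
  by rewrite -[LHS]trmxK trmx_dlsub Ysym Yur trmx0.
have [|Q [d [QQT YQ]]] := IHn (drsubmx Y).
  by apply/symmetricmxP; rewrite trmx_drsub Ysym.
pose B : 'M[R]_(1 + n) := block_mx 1%:M 0 0 Q; pose H' : 'M[R]_(1 + n) := H.
suff: (B *m H') *m (B *m H')^T = 1%:M /\
    X = (B *m H')^T *m diag_mx (row_mx (a%:M : 'M[R]_1) d) *m (B *m H').
  by exists (B *m H'), (row_mx (a%:M : 'M[R]_1) d).
have BT : B^T = block_mx 1%:M 0 0 Q^T by rewrite tr_block_mx trmx1 !trmx0.
split.
  rewrite trmx_mul mulmxA -(mulmxA _ H') HHT mulmx1 BT mulmx_block.
  by rewrite !mulmx0 !mul0mx !addr0 !add0r QQT mulmx1 -scalar_mx_block.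
rewrite XE YE YQ trmx_mul !mulmxA; congr (_ *m _); rewrite -!mulmxA; congr (_ *m _).
rewrite BT diag_mx_row !mulmx_block.
rewrite !mulmx0 !mul0mx !addr0 !add0r mulmx1 mul1mx mulmxA.
rewrite (_ : diag_mx (a%:M : 'M[R]_1) = a%:M) ?mul1mx ?mulmx0 //.
by apply/matrixP => i j; rewrite !ord1 !mxE.
Qed.

(** * Exponential, entropy and traces in a diagonalizing basis *)

Lemma cvg_mx_coord (T : topologicalType) (I : Type) (F : set_system I)
    (FF : Filter F) (m n : nat) (f : I -> 'M[T]_(m, n)) (l : 'M[T]_(m, n)) :
  (forall i j, f x i j @[x --> F] --> l i j) -> f x @[x --> F] --> l.
Proof.
move=> fl B [Q lQ QB]; apply: (@filterS _ F _ [set x | forall i j, Q i j (f x i j)]).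
  by move=> x Qx; exact: QB.
apply: filter_forall => i; apply: filter_forall => j; exact: (fl i j _ (lQ i j)).
Qed.

Lemma orthogonal_conj_diagE (R : comNzRingType) (n : nat) (P : 'M[R]_n)
    (d : 'rV[R]_n) i j :
  (P^T *m diag_mx d *m P) i j = \sum_k P k i * d 0 k * P k j.
Proof. by rewrite mul_mx_diag !mxE; apply: eq_bigr => k _; rewrite !mxE. Qed.

Lemma expmx_conj_diag (R : realType) (n : nat) (P : 'M[R]_n) (d : 'rV[R]_n) :
  P *m P^T = 1%:M ->
  expmx (P^T *m diag_mx d *m P) = P^T *m diag_mx (map_mx expR d) *m P.
Proof.
move=> PPT.
have powE k : (P^T *m diag_mx d *m P) ^+ k = P^T *m diag_mx (map_mx (fun x => x ^+ k) d) *m P.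
  elim: k => [|k IHk].
    rewrite expr0 (_ : map_mx _ d = const_mx 1) ?diag_const_mx ?mulmx1; first exact/esym/mulmx1C.
    by apply/rowP => j; rewrite !mxE.
  rewrite exprS IHk -[LHS]/(_ *m _) !mulmxA -(mulmxA _ P) PPT mulmx1.
  rewrite -(mulmxA P^T) mulmx_diag; congr (_ *m diag_mx _ *m _).
  by apply/rowP => j; rewrite !mxE exprS.
apply: (cvg_lim (@norm_hausdorff _ _)).
apply: cvg_mx_coord => i j; rewrite orthogonal_conj_diagE.
(* Each entry of a partial sum is a fixed finite combination of scalar partial sums of the
   exponential series, so convergence reduces to the scalar case. *)
rewrite (_ : (fun x => _) = (fun N => \sum_k P k i * series (exp_coeff (d 0 k)) N * P k j)).
  apply: (cvg_big (op := +%R)) => [|k _]; first exact: add_continuous.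
  rewrite mxE.
  by apply: cvgMr_tmp; apply: cvgMl_tmp; exact: is_cvg_series_exp_coeff.
apply/funext => N; rewrite /series /= summxE.
transitivity (\sum_(0 <= q < N) \sum_k q`!%:R^-1 * (P k i * d 0 k ^+ q * P k j)).
  apply: eq_bigr => q _; rewrite powE -mulr_sumr [LHS]mxE orthogonal_conj_diagE.
  by congr (_ * _); apply: eq_bigr => k _; rewrite mxE.
rewrite exchange_big; apply: eq_bigr => k _ /=.
rewrite mulr_sumr mulr_suml; apply: eq_bigr => q _.
by rewrite /exp_coeff /=; ring.
Qed.

Lemma char_poly_conj_diag (R : comNzRingType) (n : nat) (P : 'M[R]_n) (d : 'rV[R]_n) :
  P *m P^T = 1%:M ->
  char_poly (P^T *m diag_mx d *m P) = \prod_j ('X - (d 0 j)%:P).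
Proof.
move=> PPT; have PTP := mulmx1C PPT.
rewrite /char_poly.
have -> : char_poly_mx (P^T *m diag_mx d *m P) =
    map_mx polyC P^T *m char_poly_mx (diag_mx d) *m map_mx polyC P.
  rewrite /char_poly_mx mulmxBr mulmxBl -!map_mxM; congr (_ - _).
  by rewrite mul_mx_scalar -scalemxAl -map_mxM PTP map_mx1 scalemx1.
rewrite !det_mulmx mulrAC -det_mulmx -map_mxM PTP map_mx1 det1 mul1r.
rewrite -/(char_poly _) char_poly_trig ?diag_mx_is_trig //.
by apply: eq_bigr => j _; rewrite mxE eqxx.
Qed.

(** A split monic polynomial determines its roots up to permutation, so the unspecified order in
    [eigenvalues] does not affect the sum. *)
Lemma tr_xlnx_conj_diag (R : realType) (n : nat) (P : 'M[R]_n) (d : 'rV[R]_n) :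
  P *m P^T = 1%:M ->
  tr_xlnx (P^T *m diag_mx d *m P) = \sum_j d 0 j * ln (d 0 j).
Proof.
move=> PPT; set X := _ *m P; pose s := [seq d 0 j | j <- index_enum 'I_n].
have Xs : char_poly X = \prod_(a <- s) ('X - a%:P).
  by rewrite char_poly_conj_diag // big_map.
have Xe : char_poly X = \prod_(a <- eigenvalues X) ('X - a%:P).
  (* The list [s] is a valid factorization, which rules out the default value of [xget]. *)
  by rewrite /eigenvalues; case: xgetP => [t _ //|/(_ s)]; case.
rewrite /tr_xlnx (perm_big s) ?big_map //.
by apply: prod_XsubC_eq; rewrite -Xe.
Qed.

Lemma mxtrace_conj_diag (R : comNzRingType) (n : nat) (P : 'M[R]_n) (d : 'rV[R]_n) :
  P *m P^T = 1%:M -> \tr (P^T *m diag_mx d *m P) = \sum_j d 0 j.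
Proof. by move=> PPT; rewrite mxtrace_mulC mulmxA PPT mul1mx mxtrace_diag. Qed.

Lemma mxtrace_mul_conj_diag (R : comNzRingType) (n : nat) (P Q : 'M[R]_n) (d e : 'rV[R]_n) :
  \tr (P^T *m diag_mx d *m P *m (Q^T *m diag_mx e *m Q)) =
  \sum_i \sum_j (P *m Q^T) i j ^+ 2 * (d 0 i * e 0 j).
Proof.
set W := P *m Q^T; have WT : W^T = Q *m P^T by rewrite trmx_mul trmxK.
rewrite -!mulmxA mxtrace_mulC -!mulmxA -WT !mulmxA -(mulmxA _ P) -/W.
rewrite mul_diag_mx mul_mx_diag; apply: eq_bigr => i _; rewrite mxE.
by apply: eq_bigr => j _; rewrite !mxE; ring.
Qed.

Lemma orthogonal_row_sqsum (R : comNzRingType) (n : nat) (W : 'M[R]_n) i :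
  W *m W^T = 1%:M -> \sum_j W i j ^+ 2 = 1.
Proof.
move=> WWT; transitivity ((W *m W^T) i i); last by rewrite WWT mxE eqxx.
by rewrite mxE; apply: eq_bigr => j _; rewrite mxE expr2.
Qed.

(** * Klein's inequality, scalar and matrix forms *)

(** The Fenchel-Young gap of the convex function [s ln s - s], whose conjugate is [exp t]. *)
Definition klein_gap (R : realType) (s t : R) : R :=
  s * ln s - s - s * t + expR t.

Lemma klein_gap_exp (R : realType) (t : R) : klein_gap (expR t) t = 0.
Proof. by rewrite /klein_gap expRK; ring. Qed.

(** At [s = 0] the gap is [exp t]. For [s > 0], with [y = t - ln s], it equals [s (exp y - 1 - y)],
    positive because [y] is nonzero. *)
Lemma klein_gap_gt0 (R : realType) (s t : R) :
  0 <= s -> s != expR t -> 0 < klein_gap s t.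
Proof.
rewrite le_eqVlt => /predU1P[<- _|s0 st].
  by rewrite /klein_gap !mul0r !subr0 add0r expR_gt0.
have y0 : t - ln s != 0.
  by apply: contra st; rewrite subr_eq0 => /eqP ->; rewrite lnK.
have := expR_gt1Dx y0; rewrite expRD expRN lnK // -(ltr_pM2r s0) mulfVK ?gt_eqF //.
rewrite /klein_gap; lra.
Qed.

Lemma klein_gap_ge0 (R : realType) (s t : R) : 0 <= s -> 0 <= klein_gap s t.
Proof.
move=> s0; have [->|st] := eqVneq s (expR t); first by rewrite klein_gap_exp.
exact/ltW/klein_gap_gt0.
Qed.

Definition free_energy (R : realType) (n : nat) (X M : 'M[R]_n) : R :=
  tr_xlnx X - \tr X - \tr (X *m M).

Lemma klein_identity (R : realType) (n : nat) (P Q : 'M[R]_n) (d e : 'rV[R]_n)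
    (X := P^T *m diag_mx d *m P) (M := Q^T *m diag_mx e *m Q) :
  P *m P^T = 1%:M -> Q *m Q^T = 1%:M ->
  free_energy X M + \tr (expmx M) =
  \sum_i \sum_j (P *m Q^T) i j ^+ 2 * klein_gap (d 0 i) (e 0 j).
Proof.
move=> PPT QQT; have WWT : P *m Q^T *m (P *m Q^T)^T = 1%:M.
  by rewrite trmx_mul trmxK mulmxA -(mulmxA P) (mulmx1C QQT) mulmx1.
rewrite /free_energy tr_xlnx_conj_diag // mxtrace_mul_conj_diag.
rewrite expmx_conj_diag // !mxtrace_conj_diag //.
set W := P *m Q^T in WWT *.
(* The squared entries of the orthogonal matrix [W] are doubly stochastic: terms in [d] alone are
   spread along rows, terms in [e] alone along columns, giving a common double sum. *)
have rowE (f : 'I_n -> R) : \sum_i f i = \sum_i \sum_j W i j ^+ 2 * f i.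
  by apply: eq_bigr => i _; rewrite -mulr_suml orthogonal_row_sqsum ?mul1r.
have colE (f : 'I_n -> R) : \sum_j f j = \sum_i \sum_j W i j ^+ 2 * f j.
  rewrite exchange_big; apply: eq_bigr => j _; rewrite -mulr_suml.
  rewrite (_ : \sum_i W i j ^+ 2 = 1) ?mul1r //.
  rewrite -(@orthogonal_row_sqsum _ _ W^T j) ?trmxK; last exact: mulmx1C.
  by apply: eq_bigr => i _; rewrite [W^T _ _]mxE.
rewrite (rowE (fun j => d 0 j * _)) (rowE (fun j => d 0 j)).
rewrite (colE (fun j => map_mx expR e 0 j)) -!sumrB -big_split.
apply: eq_bigr => i _; rewrite -!sumrB -big_split; apply: eq_bigr => j _.
by rewrite /klein_gap [map_mx _ _ _ _]mxE /=; ring.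
Qed.

Lemma psdmx_conj_diag (R : realFieldType) (n : nat) (P : 'M[R]_n) (d : 'rV[R]_n) :
  P *m P^T = 1%:M ->
  psdmx (P^T *m diag_mx d *m P) <-> forall i, 0 <= d 0 i.
Proof.
have E (v : 'cV[R]_n) : (v^T *m (P^T *m diag_mx d *m P) *m v) 0 0 =
    \sum_i d 0 i * (P *m v) i 0 ^+ 2.
  rewrite !mulmxA -trmx_mul -mulmxA; move: (P *m v) => u.
  by rewrite mul_mx_diag mxE; apply: eq_bigr => i _; rewrite !mxE expr2 mulrCA mulrA.
move=> PPT; split=> [Xpsd i|d0 v].
  (* Testing on the eigenvector [P^T e_i] isolates the eigenvalue [d 0 i]. *)
  have := Xpsd (P^T *m delta_mx i 0); rewrite E (bigD1 i) //= big1 => [|k ki].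
    by rewrite mulmxA PPT mul1mx mxE !eqxx expr1n mulr1 addr0.
  by rewrite mulmxA PPT mul1mx mxE (negbTE ki) expr0n mulr0.
by rewrite E; apply: sumr_ge0 => i _; rewrite mulr_ge0 ?sqr_ge0.
Qed.

(** With [W = P Q^T], the equality becomes [D W = W E], that is [(d_i - e_j) W_ij = 0] for all
    entries. This form matches the equality case of Klein's inequality and reduces injectivity of
    [expmx] to that of [expR]. *)
Lemma orthogonal_conj_diag_eq (R : idomainType) (n : nat) (P Q : 'M[R]_n)
    (d e : 'rV[R]_n) :
  P *m P^T = 1%:M -> Q *m Q^T = 1%:M ->
  P^T *m diag_mx d *m P = Q^T *m diag_mx e *m Q <->
  (forall i j, (P *m Q^T) i j != 0 -> d 0 i = e 0 j).
Proof.
move=> PPT QQT.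
have WE (W : 'M[R]_n) : diag_mx d *m W = W *m diag_mx e <->
    (forall i j, W i j != 0 -> d 0 i = e 0 j).
  rewrite mul_diag_mx mul_mx_diag; split=> [/matrixP WE i j Wij|WE].
    by have := WE i j; rewrite !mxE mulrC => /(mulfI Wij).
  apply/matrixP => i j; rewrite !mxE; have [->|/WE ->] := eqVneq (W i j) 0.
    by rewrite mulr0 mul0r.
  by rewrite mulrC.
rewrite -WE; split=> [/(congr1 (fun Y => P *m Y *m Q^T))|/(congr1 (fun Y => P^T *m Y *m Q))].
  rewrite !mulmxA PPT mul1mx -!mulmxA QQT mulmx1 !mulmxA.
  by [].
by rewrite !mulmxA (mulmx1C PPT) mul1mx -!mulmxA (mulmx1C QQT) mulmx1 !mulmxA.
Qed.

Lemma symmetricmx_conj_diag (F : fieldType) (n : nat) (P : 'M[F]_n) (d : 'rV[F]_n) :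
  P^T *m diag_mx d *m P \is symmetricmx.
Proof. by apply/symmetricmxP; rewrite !trmx_mul trmxK tr_diag_mx mulmxA. Qed.

(** * Variational principle for the free energy and strict convexity of [Tr exp] *)

Section FreeEnergy.
Context (R : realType) (n : nat).
Implicit Types X M N : 'M[R]_n.

Lemma symmetricmx_expmx M : M \is symmetricmx -> expmx M \is symmetricmx.
Proof.
move=> /symmetric_diagonalizable[P [d [PPT ->]]].
by rewrite expmx_conj_diag // symmetricmx_conj_diag.
Qed.

Lemma psdmx_expmx M : M \is symmetricmx -> psdmx (expmx M).
Proof.
move=> /symmetric_diagonalizable[P [d [PPT ->]]].
by rewrite expmx_conj_diag // psdmx_conj_diag // => i; rewrite mxE expR_ge0.
Qed.

Lemma expmx_inj_symmetric : {in symmetricmx &, injective (@expmx R n)}.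
Proof.
move=> M N /symmetric_diagonalizable[P [d [PPT ->]]].
move=> /symmetric_diagonalizable[Q [e [QQT ->]]].
rewrite !expmx_conj_diag // => /orthogonal_conj_diag_eq-/(_ PPT QQT) de.
by apply/orthogonal_conj_diag_eq => // i j /de; rewrite !mxE => /expR_inj.
Qed.

Lemma free_energy_expmx M :
  M \is symmetricmx -> free_energy (expmx M) M = - \tr (expmx M).
Proof.
move=> /symmetric_diagonalizable[P [d [PPT ->]]].
(* The two matrices share the basis [P], so [W] is the identity: off-diagonal weights vanish, and
   the diagonal gaps are zero. *)
apply/eqP; rewrite -addr_eq0 {1}expmx_conj_diag // klein_identity // PPT.
apply/eqP; rewrite big1 // => i _; rewrite big1 // => j _; rewrite !mxE.
by have [->|] := eqVneq i j; rewrite ?klein_gap_exp ?mulr0 // expr0n mul0r.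
Qed.

Lemma free_energy_leif X M : X \is symmetricmx -> M \is symmetricmx -> psdmx X ->
  - \tr (expmx M) <= free_energy X M ?= iff (X == expmx M).
Proof.
move=> /symmetric_diagonalizable[P [d [PPT XE]]] Msym Xpsd.
have [Q [e [QQT ME]]] := symmetric_diagonalizable Msym.
have d0 i : 0 <= d 0 i by move: Xpsd i; rewrite XE; case: (psdmx_conj_diag d PPT).
have term_ge0 i j : 0 <= (P *m Q^T) i j ^+ 2 * klein_gap (d 0 i) (e 0 j).
  by rewrite mulr_ge0 ?sqr_ge0 ?klein_gap_ge0.
have E := klein_identity d e PPT QQT; rewrite -XE -ME in E.
split.
  by rewrite -subr_ge0 opprK E; apply: sumr_ge0 => i _; apply: sumr_ge0.
apply/idP/eqP => [XM|->]; last by rewrite free_energy_expmx.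
(* In the equality case a sum of nonnegative terms is zero, so each gap with [W i j] nonzero
   vanishes, which forces [d 0 i = expR (e 0 j)]. *)
rewrite XE ME expmx_conj_diag //; apply/orthogonal_conj_diag_eq => // i j Wij.
move: XM; rewrite eq_sym -subr_eq0 opprK E psumr_eq0 => [|k _]; last exact: sumr_ge0.
move=> /allP/(_ i (mem_index_enum _))/implyP/(_ isT).
rewrite psumr_eq0 => [|k _ //] /allP/(_ j (mem_index_enum _))/implyP/(_ isT).
rewrite mulf_eq0 sqrf_eq0 (negbTE Wij) /= mxE => gap0; apply/eqP.
by apply: contraTT gap0 => de; rewrite gt_eqF // klein_gap_gt0.
Qed.

Lemma mxtrace_expmx_strictly_convex M N (t : R) :
  M \is symmetricmx -> N \is symmetricmx -> M != N -> 0 < t < 1 ->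
  \tr (expmx (t *: M + (1 - t) *: N)) < t * \tr (expmx M) + (1 - t) * \tr (expmx N).
Proof.
move=> Msym Nsym MN /andP[t0 t1]; set L := _ + _.
have Lsym : L \is symmetricmx by rewrite rpredD ?rpredZ.
have XM := free_energy_leif (symmetricmx_expmx Lsym) Msym (psdmx_expmx Lsym).
have XN := free_energy_leif (symmetricmx_expmx Lsym) Nsym (psdmx_expmx Lsym).
(* Since [t < 1], the difference [L - M = (1 - t) (N - M)] is nonzero. *)
have LM : expmx L != expmx M.
  apply: contra MN => /eqP/expmx_inj_symmetric LM.
  have /eqP := LM Lsym Msym; rewrite -subr_eq0.
  have -> : L - M = (1 - t) *: (N - M).
    by rewrite /L scalerBr [_ *: M in RHS]scalerBl scale1r opprB addrAC addrC.
  by rewrite scaler_eq0 !subr_eq0 [1 == t]gt_eqF //= eq_sym.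
have LE : free_energy (expmx L) L =
    t * free_energy (expmx L) M + (1 - t) * free_energy (expmx L) N.
  rewrite /free_energy [in X in _ - X]/L mulmxDr -!scalemxAr mxtraceD !mxtraceZ; ring.
have := free_energy_expmx Lsym; rewrite LE.
(* Strictness at [M] is enough, because its weight [t] is positive; the inequality at [N] enters in
   weak form. *)
have {XM} : - \tr (expmx M) < free_energy (expmx L) M.
  by rewrite lt_neqAle XM.1 XM.2 LM.
rewrite -subr_gt0 => /(mulr_gt0 t0); have := XN.1.
have t1' : 0 <= 1 - t by rewrite subr_ge0 ltW.
rewrite -subr_ge0 => /(mulr_ge0 t1').
lra.
Qed.
End FreeEnergy.

(** * Closed form and strict concavity of the dual function *)

Theorem lemma2p5 (R : realType) (n m : nat) (C : symmat R n) (b : 'cV[R]_m)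
    (A : {linear symmat R n -> 'cV[R]_m})
    (adjA_inj : injective (adjoint A))
    (eps : R) (eps_gt0 : 0 < eps) :
  [/\ forall l : 'cV[R]_m, G_eps C b A eps l \is a fin_num,
      strictly_concave (fun l : 'cV[R]_m => fine (G_eps C b A eps l)) &
      forall l : 'cV[R]_m,
        G_eps C b A eps l = ((b^T *m l) 0 0 - eps * \tr (X_eps C A eps l))%:E].
Proof.
pose M l : 'M[R]_n := eps^-1 *: (symmat_mx (adjoint A l) - C) - 1%:M.
have X_epsE l : X_eps C A eps l = expmx (M l) by [].
have Msym l : M l \is symmetricmx.
  by rewrite rpredB ?rpredZ ?rpredB ?symmat_proof //; apply/symmetricmxP; rewrite trmx1.
(* By the choice of [M], [C - adjoint A l = - eps (M l + I)]. *)
have objE l (X : symmat R n) :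
    \tr (X *m (C - adjoint A l : symmat R n)) + eps * tr_xlnx X =
    eps * free_energy X (M l).
  rewrite (_ : symmat_mx (C - _) = - (symmat_mx (adjoint A l) - C)); last first.
    by rewrite opprB.
  rewrite /free_energy /M; move: (_ - symmat_mx C) => D.
  rewrite mulmxN mulmxBr mulmx1 -scalemxAr raddfN raddfB /= mxtraceZ; field.
  by rewrite gt_eqF.
have GE l : G_eps C b A eps l = ((b^T *m l) 0 0 - eps * \tr (X_eps C A eps l))%:E.
  rewrite /G_eps EFinB; congr (_ + _)%E; apply/eqP; rewrite eq_le; apply/andP; split.
    (* The infimum is attained at [expmx (M l)], which gives the upper bound; the lower bound is the
       variational principle. *)
    apply: ereal_inf_lbound; exists (SymMat (symmetricmx_expmx (Msym l))).
      exact: psdmx_expmx.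
    by rewrite objE free_energy_expmx // mulrN X_epsE.
  apply: le_ereal_inf_tmp => _ [X Xpsd <-]; rewrite objE lee_fin X_epsE -mulrN ler_pM2l //.
  exact: (free_energy_leif (symmat_proof X) (Msym l) Xpsd).1.
split=> // [l|x y t xy t01]; rewrite !GE //=.
have Mxy : M (t *: x + (1 - t) *: y) = t *: M x + (1 - t) *: M y.
  rewrite /M (_ : symmat_mx (adjoint A (t *: x + (1 - t) *: y)) =
    t *: symmat_mx (adjoint A x) + (1 - t) *: symmat_mx (adjoint A y)).
    by apply/matrixP => i j; rewrite !mxE; ring.
  by rewrite linearD !(linearZ_LR (adjoint A)).
(* Injectivity of the adjoint enters here: it makes the affine map [M] injective. *)
have Mneq : M x != M y.
  apply: contra xy => /eqP/addIr/scalerI Mxy'; apply/eqP/adjA_inj/val_inj.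
  by apply: addIr (Mxy' _); rewrite invr_eq0 gt_eqF.
(* Multiplication by [- eps] turns strict convexity of the trace into strict concavity; [u] and [v]
   carry the linear term. *)
have num (p q r u v : R) : p < t * q + (1 - t) * r ->
    t * (u - eps * q) + (1 - t) * (v - eps * r) < t * u + (1 - t) * v - eps * p.
  move=> pqr; rewrite -subr_gt0.
  rewrite (_ : _ - _ = eps * (t * q + (1 - t) * r - p)); last by ring.
  by rewrite mulr_gt0 ?subr_gt0.
have -> : (b^T *m (t *: x + (1 - t) *: y)) 0 0 =
    t * (b^T *m x) 0 0 + (1 - t) * (b^T *m y) 0 0.
  by rewrite mulmxDr -!scalemxAr; move: (b^T *m x) (b^T *m y) => u v; rewrite !mxE.
apply: num; rewrite !X_epsE Mxy.
exact: mxtrace_expmx_strictly_convex.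
Qed.
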